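(* Let $g:\mathbb{R}^m\times\mathbb{R}^n\to\mathbb{R}$ be a real-valued function and $\mathcal{Y}:\mathbb{R}^m\rightrightarrows\mathbb{R}^n$ a set-valued function. Let $\phi(x):=\max_{y\in\mathcal{Y}(x)}g(x,y)$ and $\mathcal{D}:=\{x\in\mathbb{R}^m:\phi(x)>-\infty\}$. Assume that $\mathcal{D}$ is a nonempty closed convex set, that $\mathcal{Y}$ is $L_{\mathcal{Y}}$-smooth on $\mathcal{D}$ (in the sense of set smoothness), and that $g$ is $M_g$-Lipschitz continuous with respect to $y$ and $L_g$-smooth on $\mathcal{D}\times\mathrm{Conv}\left(\bigcup_{x\in\mathcal{D}}\mathcal{Y}(x)\right)$. Then the function $\phi$ is $\rho$-weakly convex on $\mathcal{D}$ with $$\rho=M_gL_{\mathcal{Y}}+L_g(1+L_{\mathcal{Y}}).$$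
   Context: Norms are Euclidean and $\mathrm{Conv}$ denotes the convex hull. The maximum over $\mathcal{Y}(x)$ is understood as a supremum, equal to $-\infty$ when $\mathcal{Y}(x)=\emptyset$; thus $\mathcal{D}=\mathrm{dom}(\mathcal{Y})=\{x:\mathcal{Y}(x)\neq\emptyset\}$. Set smoothness: a set-valued function $\mathcal{Y}:\mathbb{R}^m\rightrightarrows\mathbb{R}^n$ with convex domain is $L$-smooth if for any $x_1,x_2\in\mathrm{dom}(\mathcal{Y})$, any $\theta\in[0,1]$, and all $y\in\mathcal{Y}(\theta x_1+(1-\theta)x_2)$, there exist $y_1\in\mathcal{Y}(x_1)$ and $y_2\in\mathcal{Y}(x_2)$ such that $$\|\theta y_1+(1-\theta)y_2-y\|\le\frac{L}{2}\theta(1-\theta)\|x_1-x_2\|^2\quad\text{and}\quad\|y_1-y_2\|^2\le L\|x_1-x_2\|^2.$$ $g$ is $L_g$-smooth on a set if it is differentiable with $L_g$-Lipschitz gradient (with respect to the joint variable $(x,y)$) on that set. $\phi$ is $\rho$-weakly convex on the convex set $\mathcal{D}$ if $x\mapsto\phi(x)+\frac{\rho}{2}\|x\|^2$ is convex on $\mathcal{D}$; equivalently, for all $\theta\in[0,1]$ and $x_1,x_2\in\mathcal{D}$, $\phi(\theta x_1+(1-\theta)x_2)\le\theta\phi(x_1)+(1-\theta)\phi(x_2)+\frac{\rho}{2}\theta(1-\theta)\|x_1-x_2\|^2$. *)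

(* Defs.v *)
From HB Require Import structures.
From mathcomp Require Import all_boot all_order all_algebra.
From mathcomp Require Import all_classical all_reals all_analysis.

Set Implicit Arguments.
Unset Strict Implicit.
Unset Printing Implicit Defensive.

Import Order.TTheory GRing.Theory Num.Theory.
Import numFieldNormedType.Exports.

Local Open Scope classical_set_scope.
Local Open Scope ring_scope.

(* The canonical norm `|x| on matrices is the max norm, so the Euclidean norm
   has to be introduced separately. Both induce the same topology and the same
   differentials, hence [closed] and [differentiable] are those of the library. *)
Definition enorm (R : realType) (k : nat) (x : 'rV[R]_k) : R :=
  Num.sqrt (\sum_(i < k) x 0 i ^+ 2).

Definition Conv (R : realType) (k : nat) (A : set 'rV[R]_k) : set 'rV[R]_k :=
  smallest (fun C : set 'rV[R]_k => convex_set C) A.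

Definition dom (R : realType) (m n : nat) (Y : 'rV[R]_m -> set 'rV[R]_n) :
  set 'rV[R]_m := [set x | Y x !=set0].

Definition set_smooth (R : realType) (m n : nat) (L : R)
    (Y : 'rV[R]_m -> set 'rV[R]_n) : Prop :=
  convex_set (dom Y) /\
  forall (x1 x2 : 'rV[R]_m) (theta : R), dom Y x1 -> dom Y x2 ->
    0 <= theta <= 1 ->
    forall y, Y (theta *: x1 + (1 - theta) *: x2) y ->
    exists y1 y2, [/\ Y x1 y1, Y x2 y2,
      enorm (theta *: y1 + (1 - theta) *: y2 - y)
        <= L / 2 * theta * (1 - theta) * enorm (x1 - x2) ^+ 2 &
      enorm (y1 - y2) ^+ 2 <= L * enorm (x1 - x2) ^+ 2].

Definition gradient (R : realType) (k : nat) (f : 'rV[R]_k -> R)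
    (z : 'rV[R]_k) : 'rV[R]_k :=
  \row_(i < k) 'D_(delta_mx 0 i) f z.

Definition smooth_on (R : realType) (k : nat) (L : R) (S : set 'rV[R]_k)
    (f : 'rV[R]_k -> R) : Prop :=
  (forall z, S z -> differentiable f z) /\
  (forall z1 z2, S z1 -> S z2 ->
    enorm (gradient f z1 - gradient f z2) <= L * enorm (z1 - z2)).

(* R^m x R^n is identified with R^(m + n), the pair (x, y) being [row_mx x y],
   so that [enorm] and [gradient] apply to the joint variable. *)
Definition joint (R : realType) (m n : nat) (g : 'rV[R]_m -> 'rV[R]_n -> R)
    (z : 'rV[R]_(m + n)) : R :=
  g (lsubmx z) (rsubmx z).

Definition joint_set (R : realType) (m n : nat) (A : set 'rV[R]_m)
    (B : set 'rV[R]_n) : set 'rV[R]_(m + n) :=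
  [set z | A (lsubmx z) /\ B (rsubmx z)].

Definition lipschitz_snd_on (R : realType) (m n : nat) (M : R)
    (A : set 'rV[R]_m) (B : set 'rV[R]_n)
    (g : 'rV[R]_m -> 'rV[R]_n -> R) : Prop :=
  forall x y1 y2, A x -> B y1 -> B y2 ->
    `|g x y1 - g x y2| <= M * enorm (y1 - y2).

(* [ereal_sup set0 = -oo]; the value +oo is possible as well. *)
Definition max_value (R : realType) (m n : nat)
    (g : 'rV[R]_m -> 'rV[R]_n -> R) (Y : 'rV[R]_m -> set 'rV[R]_n)
    (x : 'rV[R]_m) : \bar R :=
  ereal_sup [set (g x y)%:E | y in Y x].

(* The library's [convex_function] is for real-valued functions only. For f with
   values in ]-oo, +oo] on D no indeterminate sum occurs, and 0 * +oo = 0. *)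
Definition econvex_on (R : realType) (k : nat) (D : set 'rV[R]_k)
    (f : 'rV[R]_k -> \bar R) : Prop :=
  forall (x1 x2 : 'rV[R]_k) (theta : R), D x1 -> D x2 -> 0 <= theta <= 1 ->
    (f (theta *: x1 + (1 - theta) *: x2)%R
       <= theta%:E * f x1 + (1 - theta)%:E * f x2)%E.

Definition weakly_convex_on (R : realType) (k : nat) (rho : R)
    (D : set 'rV[R]_k) (f : 'rV[R]_k -> \bar R) : Prop :=
  econvex_on D (fun x => f x + (rho / 2 * enorm x ^+ 2)%:E)%E.

(* Main.v *)
(* For y in Y(t x1 + (1 - t) x2), set smoothness gives y1 in Y(x1), y2 in Y(x2)
   with t y1 + (1 - t) y2 close to y; the replacement costs at most
   Mg LY / 2 t (1 - t) |x1 - x2|^2. Along the segment from (x2, y2) to (x1, y1),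
   which lies in the convex set D x C, the Lg-smooth g exceeds its chord
   by at most Lg / 2 t (1 - t) (|x1 - x2|^2 + |y1 - y2|^2), and
   |y1 - y2|^2 <= LY |x1 - x2|^2. Take the supremum over y. *)
Require Import Defs.
From HB Require Import structures.
From mathcomp Require Import all_boot all_order all_algebra.
From mathcomp Require Import all_classical all_reals all_analysis.
From mathcomp Require Import ring lra.

Import Order.TTheory GRing.Theory Num.Theory.
Import numFieldNormedType.Exports.

Local Open Scope classical_set_scope.
Local Open Scope ring_scope.

(** Trades the bundled interval weights of [convex_set] for real weights with explicit bounds. *)
Lemma convex_setP (R : realType) (k : nat) (A : set 'rV[R]_k) :
  convex_set A <-> forall x y t, A x -> A y -> 0 <= t <= 1 ->
    A (t *: x + (1 - t) *: y).
Proof.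
split=> [cA x y t Ax Ay /andP[t0 t1]|cA x y l].
  by have := cA x y (Itv01 t0 t1); rewrite !inE; apply.
rewrite !inE => Ax Ay; apply: cA => //.
by apply/andP; split.
Qed.

Lemma convex_Conv (R : realType) (k : nat) (A : set 'rV[R]_k) :
  convex_set (Conv A).
Proof.
apply/convex_setP => x y t Ax Ay t01 B [cB AB].
move/convex_setP: (cB); apply => //; [exact: Ax|exact: Ay].
Qed.

Lemma enorm_ge0 (R : realType) (k : nat) (x : 'rV[R]_k) : 0 <= enorm x.
Proof. exact: sqrtr_ge0. Qed.

Lemma sqr_enorm (R : realType) (k : nat) (x : 'rV[R]_k) :
  enorm x ^+ 2 = \sum_(i < k) x 0 i ^+ 2.
Proof. by rewrite sqr_sqrtr// sumr_ge0// => i _; exact: sqr_ge0. Qed.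

Lemma enorm_eq0 (R : realType) (k : nat) (x : 'rV[R]_k) :
  (enorm x == 0) = (x == 0).
Proof.
apply/eqP/eqP => [x0|->]; last first.
  by rewrite /enorm big1 ?sqrtr0// => i _; rewrite mxE expr0n.
have /eqP : enorm x ^+ 2 = 0 by rewrite x0 expr0n.
rewrite sqr_enorm psumr_eq0 => [/allP h|i _]; last exact: sqr_ge0.
apply/rowP => i; rewrite mxE; apply/eqP; rewrite -sqrf_eq0.
by apply: h; rewrite mem_index_enum.
Qed.

Lemma enormZ (R : realType) (k : nat) (a : R) (x : 'rV[R]_k) :
  enorm (a *: x) = `|a| * enorm x.
Proof.
rewrite /enorm -sqrtr_sqr -sqrtrM ?sqr_ge0// mulr_sumr.
by congr Num.sqrt; apply: eq_bigr => i _; rewrite mxE exprMn.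
Qed.

Lemma sqr_enorm_row_mx (R : realType) (m n : nat) (x : 'rV[R]_m)
    (y : 'rV[R]_n) :
  enorm (row_mx x y) ^+ 2 = enorm x ^+ 2 + enorm y ^+ 2.
Proof.
rewrite !sqr_enorm big_split_ord/=.
by congr (_ + _); apply: eq_bigr => i _; rewrite ?row_mxEl ?row_mxEr.
Qed.

(** A polynomial identity in each coordinate. It turns the quadratic term of weak convexity into the
    defect [t * (1 - t) * enorm (x - y) ^+ 2]. *)
Lemma sqr_enorm_conv (R : realType) (k : nat) (t : R) (x y : 'rV[R]_k) :
  enorm (t *: x + (1 - t) *: y) ^+ 2 =
  t * enorm x ^+ 2 + (1 - t) * enorm y ^+ 2
    - t * (1 - t) * enorm (x - y) ^+ 2.
Proof.
rewrite !sqr_enorm !mulr_sumr -big_split/= -sumrB.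
by apply: eq_bigr => i _; rewrite !mxE; ring.
Qed.

Lemma cauchy_schwarz (R : realType) (k : nat) (a b : 'rV[R]_k) :
  \sum_(i < k) a 0 i * b 0 i <= enorm a * enorm b.
Proof.
have [a0|a0] := eqVneq (enorm a) 0.
  rewrite a0 mul0r; move/eqP: a0; rewrite enorm_eq0 => /eqP ->.
  by rewrite big1// => i _; rewrite mxE mul0r.
have [b0|b0] := eqVneq (enorm b) 0.
  rewrite b0 mulr0; move/eqP: b0; rewrite enorm_eq0 => /eqP ->.
  by rewrite big1// => i _; rewrite mxE mulr0.
have ab0 : 0 < enorm a * enorm b by rewrite mulr_gt0// lt0r ?a0 ?b0 enorm_ge0.
(* Expanding this square gives twice [enorm a * enorm b] times the desired inequality. *)
have : 0 <= \sum_(i < k) (enorm b * a 0 i - enorm a * b 0 i) ^+ 2.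
  by rewrite sumr_ge0// => i _; exact: sqr_ge0.
rewrite [X in 0 <= X](_ : _ =
    enorm b ^+ 2 * \sum_(i < k) a 0 i ^+ 2
    + enorm a ^+ 2 * \sum_(i < k) b 0 i ^+ 2
    - 2 * (enorm a * enorm b) * \sum_(i < k) a 0 i * b 0 i); last first.
  rewrite !mulr_sumr -big_split -sumrB/=.
  by apply: eq_bigr => i _; ring.
by rewrite -!sqr_enorm => h; rewrite -(ler_pM2l ab0); nra.
Qed.

Lemma derive_gradient (R : realType) (k : nat) (f : 'rV[R]_k -> R)
    (z v : 'rV[R]_k) :
  differentiable f z -> 'D_v f z = \sum_(i < k) gradient f z 0 i * v 0 i.
Proof.
move=> fz; rewrite deriveE// {1}(row_sum_delta v) linear_sum.
by apply: eq_bigr => i _; rewrite linearZ/= mxE deriveE// [LHS]mulrC.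
Qed.

Lemma is_derive_segment (R : realType) (k : nat) (f : 'rV[R]_k -> R)
    (x y : 'rV[R]_k) (t : R) :
  differentiable f (t *: x + (1 - t) *: y) ->
  is_derive t 1 (fun s : R => f (s *: x + (1 - s) *: y))
    ('D_(x - y) f (t *: x + (1 - t) *: y)).
Proof.
set z := t *: x + (1 - t) *: y => fz.
(* Moving [s] by [h] moves the point of the segment by [h *: (x - y)], so both difference quotients
   coincide. *)
have E : (fun h : R => h^-1 *: (((fun s : R => f (s *: x + (1 - s) *: y))
      \o shift t) (h *: 1) - f z)) =
    (fun h => h^-1 *: ((f \o shift z) (h *: (x - y)) - f z)).
  apply/funext => h /=; congr (_ *: (f _ - _)).
  by apply/rowP => i; rewrite !mxE [h *: 1]mulr1; ring.
have := @diff_derivable _ _ _ _ _ (x - y) fz.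
split; first by rewrite /derivable E.
by rewrite /derive E.
Qed.

(* The hypothesis on [df] says that [F t + K / 2 * t ^+ 2] has nondecreasing
   derivative; the mean value theorem on both sides of [t] then gives its
   convexity. *)
Lemma semiconvex_of_derivative (R : realType) (F df : R -> R) (K t : R) :
  (forall s : R, 0 <= s <= 1 -> is_derive s 1 F (df s)) ->
  (forall a b : R, 0 <= a -> a <= b -> b <= 1 -> df a <= df b + K * (b - a)) ->
  0 <= t <= 1 ->
  F t <= t * F 1 + (1 - t) * F 0 + K / 2 * t * (1 - t).
Proof.
move=> dF dfK /andP[t0 t1].
pose G := (F + (fun s : R => K / 2 * s ^+ 2))%R.
have dG (s : R) : 0 <= s <= 1 -> is_derive s 1 G (df s + K * s).
  move=> s01; apply: is_deriveD; first exact: dF.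
  apply: (is_derive_eq (is_deriveZ _ _)).
  by rewrite /GRing.scale/=; field.
have mvt (a b : R) : 0 <= a -> a <= b -> b <= 1 ->
    exists2 c, a <= c <= b & G b - G a = (df c + K * c) * (b - a).
  move=> a0 ab b1.
  have [||c] := @MVT_segment R G (fun s => df s + K * s) a b ab.
  - move=> s; rewrite in_itv/= => /andP[as' sb]; apply: dG.
    by rewrite (le_trans a0 (ltW as')) (le_trans (ltW sb)).
  - apply: derivable_within_continuous => s; rewrite in_itv/= => /andP[as' sb].
    by have [] := dG s; rewrite ?(le_trans a0 as') ?(le_trans sb).
  - by rewrite in_itv/=; exists c.
have [c /andP[c0 ct] Ec] := mvt 0 t (lexx _) t0 t1.
have [d /andP[td d1] Ed] := mvt t 1 t0 t1 (lexx _).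
have s0 : 0 <= 1 - t by rewrite subr_ge0.
(* Weighting [Ec] by [1 - t] and [Ed] by [t] gives both slopes the factor [t * (1 - t)]; they are
   compared through [c <= t <= d]. *)
have /(ler_wpM2l (mulr_ge0 t0 s0)) := dfK c d c0 (le_trans ct td) d1.
have := congr1 ( *%R (1 - t)) Ec; have := congr1 ( *%R t) Ed.
rewrite /G /= !fctE; lra.
Qed.

(** Restricts [f] to the segment: by Cauchy-Schwarz and the Lipschitz gradient, its derivative there
    satisfies the one-variable bound with [K = L * enorm (x - y) ^+ 2]. *)
Lemma smooth_on_segment (R : realType) (k : nat) (L : R) (S : set 'rV[R]_k)
    (f : 'rV[R]_k -> R) (x y : 'rV[R]_k) (t : R) :
  convex_set S -> smooth_on L S f -> S x -> S y -> 0 <= t <= 1 ->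
  f (t *: x + (1 - t) *: y) <=
    t * f x + (1 - t) * f y + L / 2 * t * (1 - t) * enorm (x - y) ^+ 2.
Proof.
move=> /convex_setP cS [df Lf] Sx Sy t01.
pose p s : 'rV[R]_k := s *: x + (1 - s) *: y.
have Sp s : 0 <= s <= 1 -> S (p s) by move=> s01; exact: cS.
have p1 : p 1 = x by rewrite /p scale1r subrr scale0r addr0.
have p0 : p 0 = y by rewrite /p subr0 scale0r scale1r add0r.
apply: le_trans (@semiconvex_of_derivative R (f \o p)
  (fun s => 'D_(x - y) f (p s)) (L * enorm (x - y) ^+ 2) t _ _ t01) _.
- by move=> s s01; apply: is_derive_segment; exact/df/Sp.
- move=> a b a0 ab b1.
  have Sa : S (p a) by apply: Sp; rewrite a0 (le_trans ab).
  have Sb : S (p b) by apply: Sp; rewrite b1 (le_trans a0).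
  rewrite -lerBlDl !derive_gradient; [|exact: df..].
  rewrite -sumrB (eq_bigr (fun i => (gradient f (p a) - gradient f (p b)) 0 i
    * (x - y) 0 i)); last by move=> i _; rewrite !mxE; ring.
  apply: le_trans (cauchy_schwarz _ _ _ _) _.
  apply: le_trans (ler_wpM2r (enorm_ge0 _ _ _) (Lf _ _ Sa Sb)) _.
  rewrite (_ : p a - p b = (a - b) *: (x - y)); last first.
    by apply/rowP => i; rewrite !mxE; ring.
  by rewrite enormZ distrC ger0_norm ?subr_ge0//; lra.
- by rewrite /= p1 p0; lra.
Qed.

Lemma max_value_gtNy (R : realType) (m n : nat)
    (g : 'rV[R]_m -> 'rV[R]_n -> R) (Y : 'rV[R]_m -> set 'rV[R]_n) x :
  (-oo < max_value g Y x)%E <-> dom Y x.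
Proof.
split=> [/ereal_sup_gt[_ [y Yy _] _]|[y Yy]]; first by exists y.
apply: (lt_le_trans (ltNyr (g x y))).
by apply: ereal_sup_ubound; exists y.
Qed.

Theorem theorem1 (R : realType) (m n : nat)
    (g : 'rV[R]_m -> 'rV[R]_n -> R) (Y : 'rV[R]_m -> set 'rV[R]_n)
    (LY Mg Lg : R) :
  let phi := max_value g Y in
  let D := [set x | (-oo < phi x)%E] in
  let C := Conv (\bigcup_(x in D) Y x) in
  D !=set0 -> closed D -> convex_set D ->
  set_smooth LY Y ->
  0 <= Mg ->
  lipschitz_snd_on Mg D C g ->
  smooth_on Lg (joint_set D C) (joint g) ->
  weakly_convex_on (Mg * LY + Lg * (1 + LY)) D phi.
Proof.
move=> phi D C _ _ cD [_ sY] Mg0 lipg smg x1 x2 t Dx1 Dx2 t01.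
have [t0 t1] := andP t01.
set x := t *: x1 + (1 - t) *: x2; set rho := Mg * LY + _.
have Dx : D x by move/convex_setP: cD; apply.
have YC u v : D u -> Y u v -> C v.
  by move=> Du Yuv; apply: sub_gen_smallest; exists u.
have /convex_setP cC : convex_set C by exact: convex_Conv.
(* The quadratic term is finite, so it can cross the inequality and leave a bare supremum to bound
   one [y] at a time. *)
rewrite -leeBrDr//; apply: ge_ereal_sup => _ [y Yy <-].
rewrite leeBrDr//.
have [y1 [y2 [Y1 Y2 dy dY]]] :=
  sY x1 x2 t (iffLR (max_value_gtNy _ _ _ _ _ _) Dx1)
    (iffLR (max_value_gtNy _ _ _ _ _ _) Dx2) t01 y Yy.
set y' := t *: y1 + (1 - t) *: y2 in dy.
have C1 : C y1 by exact: YC Y1.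
have C2 : C y2 by exact: YC Y2.
have Cy' : C y' by exact: cC.
have Cy : C y by exact: YC Yy.
(* [y'] need not belong to [Y x]; the Lipschitz bound applies because the hull [C] contains it. *)
have gy : g x y <= g x y' + Mg * (LY / 2 * t * (1 - t) * enorm (x1 - x2) ^+ 2).
  rewrite -lerBlDl; apply: le_trans (ler_norm _) _.
  rewrite distrC; apply: le_trans (lipg _ _ _ Dx Cy' Cy) _.
  exact: ler_wpM2l.
have cJ : convex_set (joint_set D C).
  apply/convex_setP => z1 z2 s [Dz1 Cz1] [Dz2 Cz2] s01.
  rewrite /joint_set/= !linearD !linearZ/=; split; last exact: cC.
  by move/convex_setP: cD; apply.
have J1 : joint_set D C (row_mx x1 y1).
  by rewrite /joint_set/= row_mxKl row_mxKr.
have J2 : joint_set D C (row_mx x2 y2).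
  by rewrite /joint_set/= row_mxKl row_mxKr.
have := smooth_on_segment _ _ _ _ _ _ _ _ cJ smg J1 J2 t01.
rewrite !scale_row_mx add_row_mx opp_row_mx add_row_mx sqr_enorm_row_mx.
rewrite /joint !row_mxKl !row_mxKr -/x -/y' => gy'.
have Lgd : Lg * (enorm (x1 - x2) ^+ 2 + enorm (y1 - y2) ^+ 2)
    <= Lg * (1 + LY) * enorm (x1 - x2) ^+ 2.
  (* [Lg < 0] is possible, but only if [D] is a single point. *)
  have [Lg0|Lg0] := leP 0 Lg; first by nra.
  have [x12|x12] := eqVneq x1 x2.
    have e0 : enorm (x1 - x2) = 0 by apply/eqP; rewrite enorm_eq0 subr_eq0 x12.
    have -> : enorm (y1 - y2) ^+ 2 = 0.
      apply/eqP; rewrite eq_le sqr_ge0 andbT.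
      by move: dY; rewrite e0 expr0n/= mulr0.
    by rewrite e0 expr0n/= addr0 !mulr0.
  (* For distinct points, a negative [Lg] would bound a norm by a negative number. *)
  have : 0 < enorm (row_mx x1 y1 - row_mx x2 y2).
    rewrite lt0r enorm_ge0 andbT enorm_eq0 subr_eq0.
    by apply: contra x12 => /eqP/eq_row_mx[-> _].
  rewrite -(nmulr_rlt0 _ Lg0) ltNge => /negP[].
  exact: le_trans (enorm_ge0 _ _ _) (smg.2 _ _ J1 J2).
have tt0 : 0 <= t * (1 - t) by rewrite mulr_ge0// subr_ge0.
have := sqr_enorm_conv _ _ t x1 x2; rewrite -/x => Ex.
(* The errors from [gy] and [gy'] add up to at most [rho / 2 * t * (1 - t) * enorm (x1 - x2) ^+ 2],
   which the negative term of [Ex] cancels. *)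
apply: (@le_trans _ _ (t * (g x1 y1 + rho / 2 * enorm x1 ^+ 2)
    + (1 - t) * (g x2 y2 + rho / 2 * enorm x2 ^+ 2))%:E).
  rewrite -EFinD lee_fin Ex.
  by have := ler_wpM2l tt0 Lgd; rewrite /rho; lra.
(* The weights are nonnegative, and [y1], [y2] compete in the suprema at [x1], [x2]. *)
rewrite EFinD !EFinM; apply: leeD; apply: lee_wpmul2l.
- by rewrite lee_fin.
- by rewrite EFinD; apply: leeD2r; apply: ereal_sup_ubound; exists y1.
- by rewrite lee_fin subr_ge0.
- by rewrite EFinD; apply: leeD2r; apply: ereal_sup_ubound; exists y2.
Qed.
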